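(* Let $R$ be a ring, $M_1,M_2$ be $R$-modules and $N_1$ a proper submodule of $M_1$. Let $\psi_i:S(M_i)\to S(M_i)\cup\{\emptyset\}$ be functions for $i=1,2$ and let $\phi=\psi_1\times\psi_2$. Then the following conditions are equivalent: (1) $N=N_1\times M_2$ is a $\phi$-classical prime submodule of $M=M_1\times M_2$; (2) $N_1$ is a $\psi_1$-classical prime submodule of $M_1$, and for all $r,s\in R$ and $m_1\in M_1$: if $rsm_1\in\psi_1(N_1)$, $rm_1\notin N_1$ and $sm_1\notin N_1$, then $rs\in(\psi_2(M_2):_R M_2)$.
   Context: All rings are commutative with nonzero identity and all modules are unitary. For an $R$-module $M$, $S(M)$ is the set of all submodules of $M$. Standing convention: every function $\phi:S(M)\to S(M)\cup\{\emptyset\}$ considered satisfies $\phi(N)\subseteq N$ for all $N\in S(M)$. For such a function $\phi$, a proper submodule $N$ of $M$ is $\phi$-classical prime if whenever $a,b\in R$ and $m\in M$ with $abm\in N\setminus\phi(N)$, then $am\in N$ or $bm\in N$ (this depends only on the value $\phi(N)$). The notation $\phi=\psi_1\times\psi_2$ means $\phi(K_1\times K_2)=\psi_1(K_1)\times\psi_2(K_2)$ for submodules $K_i\subseteq M_i$, the product being $\emptyset$ if one factor is $\emptyset$; only the value $\phi(N_1\times M_2)=\psi_1(N_1)\times\psi_2(M_2)$ is relevant. For $X$ a submodule of $M_2$ or $X=\emptyset$, $(X:_R M_2)=\{r\in R\mid rM_2\subseteq X\}$ (empty when $X=\emptyset$). *)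

(* Defs.v *)
From HB Require Import structures.
From mathcomp Require Import all_boot all_order all_algebra.
From mathcomp Require Import boolp classical_sets.

Set Implicit Arguments.
Unset Strict Implicit.
Unset Printing Implicit Defensive.

Import GRing.Theory.
Local Open Scope ring_scope.
Local Open Scope classical_set_scope.

Record submodule (R : comNzRingType) (M : lmodType R) := Submodule {
  submod_set :> set M;
  submod_setP : submod_closed (mem submod_set) }.

(* S(M) together with the empty set: since a submodule contains 0, the union is
   disjoint, and None stands for the empty set. *)
Definition osubmodule (R : comNzRingType) (M : lmodType R) : Type :=
  option (submodule M).

Definition osubmod_set (R : comNzRingType) (M : lmodType R)
    (X : osubmodule M) : set M :=
  if X is Some N then submod_set N else set0.

Lemma full_submod_closed (R : comNzRingType) (M : lmodType R) :
  submod_closed (mem [set: M]).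
Proof. by split=> [|a u v _ _]; rewrite in_setT. Qed.

Definition full_submod (R : comNzRingType) (M : lmodType R) : submodule M :=
  Submodule (full_submod_closed M).

Lemma prod_submod_closed (R : comNzRingType) (M1 M2 : lmodType R)
    (K1 : submodule M1) (K2 : submodule M2) :
  submod_closed (mem (submod_set K1 `*` submod_set K2)).
Proof.
have [K10 K1D] := submod_setP K1; have [K20 K2D] := submod_setP K2.
split=> [|a u v]; rewrite !inE.
  by split; apply: set_mem.
move=> [u1 u2] [v1 v2]; split; apply: set_mem.
  by apply: K1D; apply: mem_set.
by apply: K2D; apply: mem_set.
Qed.

Definition prod_submod (R : comNzRingType) (M1 M2 : lmodType R)
    (K1 : submodule M1) (K2 : submodule M2) : submodule (M1 * M2)%type :=
  Submodule (prod_submod_closed K1 K2).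

Definition prod_osubmod (R : comNzRingType) (M1 M2 : lmodType R)
    (X1 : osubmodule M1) (X2 : osubmodule M2) : osubmodule (M1 * M2)%type :=
  if X1 is Some K1 then
    if X2 is Some K2 then Some (prod_submod K1 K2) else None
  else None.

Definition contracting (R : comNzRingType) (M : lmodType R)
    (phi : submodule M -> osubmodule M) : Prop :=
  forall N : submodule M, osubmod_set (phi N) `<=` submod_set N.

(* phi = psi1 x psi2; the values of phi are prescribed only on submodules of the
   form K1 x K2, and M1 x M2 may have others. *)
Definition is_prod_fun (R : comNzRingType) (M1 M2 : lmodType R)
    (phi : submodule (M1 * M2)%type -> osubmodule (M1 * M2)%type)
    (psi1 : submodule M1 -> osubmodule M1)
    (psi2 : submodule M2 -> osubmodule M2) : Prop :=
  forall (K1 : submodule M1) (K2 : submodule M2),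
    phi (prod_submod K1 K2) = prod_osubmod (psi1 K1) (psi2 K2).

Definition proper_submod (R : comNzRingType) (M : lmodType R)
    (N : submodule M) : Prop :=
  submod_set N <> [set: M].

Definition classical_prime (R : comNzRingType) (M : lmodType R)
    (phi : submodule M -> osubmodule M) (N : submodule M) : Prop :=
  proper_submod N /\
  forall (a b : R) (m : M),
    (submod_set N `\` osubmod_set (phi N)) ((a * b) *: m) ->
    submod_set N (a *: m) \/ submod_set N (b *: m).

(* (X :_R M) *)
Definition colon (R : comNzRingType) (M : lmodType R) (X : osubmodule M) :
    set R :=
  [set r | [set r *: m | m in [set: M]] `<=` osubmod_set X].

(* Main.v *)
Require Import Defs.
From HB Require Import structures.
From mathcomp Require Import all_boot all_order all_algebra.
From mathcomp Require Import boolp classical_sets.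
Import GRing.Theory.
Local Open Scope ring_scope.
Local Open Scope classical_set_scope.

(** Membership in N = N1 x M2 is decided by the first coordinate alone, while by [osubmod_set_prod]
    a pair leaves phi(N) = psi1(N1) x psi2(M2) as soon as one coordinate leaves its factor. Leaving
    through the first coordinate gives primeness of N1; leaving through the second gives the colon
    condition. *)

Lemma osubmod_set_prod (R : comNzRingType) (M1 M2 : lmodType R)
    (X1 : osubmodule M1) (X2 : osubmodule M2) :
  osubmod_set (prod_osubmod X1 X2) = osubmod_set X1 `*` osubmod_set X2.
Proof. by case: X1 X2 => [K1|] [K2|] //=; rewrite ?set0X ?setX0. Qed.

Theorem theorem2p36 (R : comNzRingType) (M1 M2 : lmodType R)
  (N1 : submodule M1)
  (psi1 : submodule M1 -> osubmodule M1)
  (psi2 : submodule M2 -> osubmodule M2)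
  (phi : submodule (M1 * M2)%type -> osubmodule (M1 * M2)%type)
  (hN1 : proper_submod N1)
  (hpsi1 : contracting psi1) (hpsi2 : contracting psi2)
  (hphi : contracting phi) (hprod : is_prod_fun phi psi1 psi2) :
  classical_prime phi (prod_submod N1 (full_submod M2)) <->
  (classical_prime psi1 N1 /\
   forall (r s : R) (m1 : M1),
     osubmod_set (psi1 N1) ((r * s) *: m1) ->
     ~ submod_set N1 (r *: m1) ->
     ~ submod_set N1 (s *: m1) ->
     colon (psi2 (full_submod M2)) (r * s)).
Proof.
rewrite /classical_prime hprod osubmod_set_prod; split.
- move=> [_ N_prime]; split; first split=> // a b m1 [N1abm1 psi1Nabm1].
    (* Any second coordinate would do: [psi1Nabm1] already keeps the pair out of the product. *)
    have [|[]|[]] := N_prime a b (m1, 0); last 2 first.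
    + by left.
    + by right.
    by split=> // -[/psi1Nabm1].
  move=> r s m1 psi1rsm1 N1Nrm1 N1Nsm1 _ [m2 _ <-]; apply: contrapT => psi2Nrsm2.
  (* Here the pair escapes phi(N) through [m2], and it lies in N because psi1(N1) is contained in
     N1. *)
  have [|[/N1Nrm1]|[/N1Nsm1]] // := N_prime r s (m1, m2).
  by split=> [|[_ /psi2Nrsm2]] //; split=> //; exact: hpsi1 psi1rsm1.
- move=> [[_ N1_prime] psi1_colon]; split=> [N_full|a b [m1 m2] [[N1abm1 _] phiN]].
    apply: hN1; apply/seteqP; split=> // m1 _.
    have : submod_set (prod_submod N1 (full_submod M2)) (m1, 0) by rewrite N_full.
    by case.
  have [N1am1|N1Nam1] := pselect (submod_set N1 (a *: m1)); first by left.
  have [N1bm1|N1Nbm1] := pselect (submod_set N1 (b *: m1)); first by right.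
  have [psi1abm1|psi1Nabm1] := pselect (osubmod_set (psi1 N1) ((a * b) *: m1)).
    (* The colon condition puts the second coordinate in psi2(M2), so the whole pair falls into
       phi(N), against [phiN]. *)
    case: phiN; split=> //.
    by apply: (psi1_colon a b m1 psi1abm1 N1Nam1 N1Nbm1); exists m2.
  by case: (N1_prime a b m1).
Qed.
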